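(* Let $\beta$ be any duality. Then the category $\mathbf{AlgH}(\beta)$ of Heisenberg algebras over $\beta$, with the tensor product $\otimes$ of Heisenberg algebras, is a symmetric monoidal category.
   Context: All algebras are associative and commutative but not necessarily unital. $G,\Gamma$ are additive abelian groups, $T$ a multiplicative abelian group. A duality is a bilinear map $\beta\colon\Gamma\times G\to T$, $(\xi,x)\mapsto\langle\xi|x\rangle$, such that $\xi\mapsto\langle\xi|\cdot\rangle$ and $x\mapsto\langle\cdot|x\rangle$ are injective. The Heisenberg group $H(\beta)$ consists of all $c\,(x,\xi)$ with $c\in T,x\in G,\xi\in\Gamma$, with product $c(x,\xi)\cdot c'(x',\xi')=cc'\langle\xi|x'\rangle(x+x',\xi+\xi')$; $T,G,\Gamma$ are identified with the subgroups of elements $c(0,0)$, $1(x,0)$, $1(0,\xi)$. $K$ is a commutative unital ring with a fixed group homomorphism $\epsilon_T\colon T\to K^*$. A Heisenberg algebra over $\beta$ is a $K$-algebra $S$ with a $K$-linear left action $\bullet$ of $H(\beta)$ on the $K$-module $S$ such that, for all $s,s'\in S$: $c\bullet s=\epsilon_T(c)s$ for $c\in T$; $x\bullet(ss')=(x\bullet s)s'$ for $x\in G$; $\xi\bullet(ss')=(\xi\bullet s)(\xi\bullet s')$ for $\xi\in\Gamma$. Morphisms in $\mathbf{AlgH}(\beta)$ are $H(\beta)$-equivariant $K$-algebra homomorphisms. Tensor product: for $S,S'\in\mathbf{AlgH}(\beta)$, view $S,S'$ as algebras over the group algebra $KG$ via the action of $G$, and let $S\otimes S':=S\otimes_{KG}S'$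 as $KG$-algebra, with $T$ acting via $\epsilon_T$, $G$ acting via the $KG$-module structure, and $\xi\in\Gamma$ acting by $\xi\bullet(s\otimes s'):=(\xi\bullet s)\otimes(\xi\bullet s')$. *)

(* Defs.v *)
From HB Require Import structures.
From mathcomp Require Import all_boot all_order all_algebra.
From mathcomp Require Import finmap boolp.
From mathcomp.multinomials Require Import monalg.

Set Implicit Arguments.
Unset Strict Implicit.
Unset Printing Implicit Defensive.

Import GRing.Theory.
Import Quotient.

Local Open Scope ring_scope.
Local Open Scope quotient_scope.

Record category := Category {
  ob :> Type;
  hom : ob -> ob -> Type;
  idm : forall A, hom A A;
  comp : forall A B D, hom B D -> hom A B -> hom A D;
  comp1m : forall A B (f : hom A B), comp (idm B) f = f;
  compm1 : forall A B (f : hom A B), comp f (idm A) = f;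
  compmA : forall A B D E (h : hom D E) (g : hom B D) (f : hom A B),
    comp h (comp g f) = comp (comp h g) f
}.

Arguments hom {c} A B.
Arguments idm {c} A.
Arguments comp {c A B D} g f.
Notation "g \c f" := (comp g f) (at level 40, left associativity).

Definition is_iso (C : category) (A B : C) (f : hom A B) :=
  exists g : hom B A, g \c f = idm A /\ f \c g = idm B.

(* Only the object part of the tensor product is a parameter; its action on
   morphisms is part of the structure. *)
Record sym_monoidal (C : category) (tens : C -> C -> C) := SymMonoidal {
  tens_map : forall (A A' B B' : C),
    hom A A' -> hom B B' -> hom (tens A B) (tens A' B');
  munit : C;
  massoc : forall A B D : C, hom (tens (tens A B) D) (tens A (tens B D));
  lunit : forall A : C, hom (tens munit A) A;
  runit : forall A : C, hom (tens A munit) A;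
  braid : forall A B : C, hom (tens A B) (tens B A);

  tens_map1 : forall A B : C, tens_map (idm A) (idm B) = idm (tens A B);
  tens_mapM : forall (A A' A'' B B' B'' : C) (f : hom A A') (f' : hom A' A'')
      (g : hom B B') (g' : hom B' B''),
    tens_map (f' \c f) (g' \c g) = tens_map f' g' \c tens_map f g;

  massoc_iso : forall A B D : C, is_iso (massoc A B D);
  lunit_iso : forall A : C, is_iso (lunit A);
  runit_iso : forall A : C, is_iso (runit A);

  massoc_nat : forall (A A' B B' D D' : C)
      (f : hom A A') (g : hom B B') (h : hom D D'),
    massoc A' B' D' \c tens_map (tens_map f g) h =
    tens_map f (tens_map g h) \c massoc A B D;
  lunit_nat : forall (A A' : C) (f : hom A A'),
    lunit A' \c tens_map (idm munit) f = f \c lunit A;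
  runit_nat : forall (A A' : C) (f : hom A A'),
    runit A' \c tens_map f (idm munit) = f \c runit A;
  braid_nat : forall (A A' B B' : C) (f : hom A A') (g : hom B B'),
    braid A' B' \c tens_map f g = tens_map g f \c braid A B;

  pentagon : forall A B D E : C,
    massoc A B (tens D E) \c massoc (tens A B) D E =
    tens_map (idm A) (massoc B D E) \c massoc A (tens B D) E
      \c tens_map (massoc A B D) (idm E);
  triangle : forall A B : C,
    tens_map (idm A) (lunit B) \c massoc A munit B =
    tens_map (runit A) (idm B);
  hexagon : forall A B D : C,
    massoc B D A \c braid A (tens B D) \c massoc A B D =
    tens_map (idm B) (braid A D) \c massoc B A D
      \c tens_map (braid A B) (idm D);
  braidK : forall A B : C, braid B A \c braid A B = idm (tens A B)
}.

HB.lock Definition malg_lift (I : choiceType) (A V : zmodType)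
  (F : I -> A -> V) (a : {malg A[I]}) : V := \sum_(i <- msupp a) F i a@_i.
Arguments malg_lift {I A V} F a.

Section MalgLift.
Variables (I : choiceType) (A V : zmodType).
Implicit Types (F : I -> A -> V) (a b : {malg A[I]}).

Definition additive_family F := forall i c d, F i (c + d) = F i c + F i d.

Lemma additive_family0 F i : additive_family F -> F i 0 = 0.
Proof. by move=> FD; apply: (addIr (F i 0)); rewrite -FD !add0r. Qed.

Lemma malg_liftw F (S : {fset I}) a : additive_family F ->
  (msupp a `<=` S)%fset -> malg_lift F a = \sum_(i <- S) F i a@_i.
Proof.
move=> FD le; rewrite malg_lift.unlock.
rewrite [LHS](big_fset_incl _ le) => //= i _ /mcoeff_outdom ->.
exact: additive_family0.
Qed.

Lemma malg_liftD F : additive_family F -> {morph malg_lift F : a b / a + b}.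
Proof.
move=> FD a b; pose S := (msupp a `|` msupp b)%fset.
rewrite !(@malg_liftw F S) ?fsubsetUl ?fsubsetUr ?msuppD_le //.
by rewrite -big_split; apply: eq_bigr => i _; rewrite mcoeffD FD.
Qed.

Lemma malg_liftU F i c : additive_family F -> malg_lift F << c *g i >> = F i c.
Proof. by move=> FD; rewrite (malg_liftw FD msuppU_le) big_seq_fset1 mcoeffUU. Qed.

Lemma eq_malg_lift F F' a : (forall i c, F i c = F' i c) ->
  malg_lift F a = malg_lift F' a.
Proof. by move=> eqF; rewrite malg_lift.unlock; apply: eq_bigr. Qed.

Lemma malg_liftDf F F' a :
  malg_lift (fun i c => F i c + F' i c) a = malg_lift F a + malg_lift F' a.
Proof. by rewrite malg_lift.unlock; apply: big_split. Qed.

End MalgLift.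

Lemma monalgUz (I : choiceType) (i : I) (k : int) :
  << k *g i >> = << i >> *~ k :> {malg int[I]}.
Proof.
apply/malgP => j; rewrite raddfMz /= !mcoeffU.
by case: (i == j); rewrite ?mulr1n ?mulr0n ?mul0rz // intz.
Qed.

Lemma malg_ind (I : choiceType) (A : zmodType) (P : {malg A[I]} -> Prop) :
    P 0 -> (forall i c, P << c *g i >>) ->
    (forall a b, P a -> P b -> P (a + b)) ->
  forall a, P a.
Proof.
move=> P0 PU PD a; rewrite [a]monalgE.
elim: (enum_fset (msupp a)) => [|i s IHs]; first by rewrite big_nil.
by rewrite big_cons; apply: PD.
Qed.

(* {malg K[G]} is the K-module of finitely supported families; the product of
   the library is unavailable here, as it presupposes a monoid of monomials,
   in which only the neutral element is invertible. *)
Definition group_alg (K : comPzRingType) (G : zmodType) : Type := {malg K[G]}.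

Section GroupAlgebra.
Variables (K : comPzRingType) (G : zmodType).
Local Notation KG := (group_alg K G).

HB.instance Definition _ := GRing.Zmodule.copy KG {malg K[G]}.

(* The element c x of KG. *)
Definition gelt (c : K) (x : G) : KG := << c *g x >>.

Definition gone : KG := gelt 1 0.
Definition gmul (a b : KG) : KG :=
  malg_lift (fun x c => malg_lift (fun y d => gelt (c * d) (x + y)) b) a.

Lemma geltD x : {morph gelt^~ x : c d / c + d}.
Proof. exact: monalgUD. Qed.

Lemma galg_ind (P : KG -> Prop) :
  P 0 -> (forall c x, P (gelt c x)) -> (forall a b, P a -> P b -> P (a + b)) ->
  forall a, P a.
Proof. by move=> P0 PU PD; apply: malg_ind => // x c; apply: PU. Qed.

Fact gmul_fam1 x (c : K) :
  additive_family (fun y d => gelt (c * d) (x + y) : {malg K[G]}).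
Proof. by move=> y d d'; rewrite mulrDr geltD. Qed.

Fact gmul_fam2 (b : KG) : additive_family (fun x c =>
  malg_lift (fun y d => gelt (c * d) (x + y) : {malg K[G]}) b).
Proof.
move=> x c c'; rewrite -malg_liftDf; apply: eq_malg_lift => y d.
by rewrite mulrDl geltD.
Qed.

Lemma gmulDl : left_distributive gmul +%R.
Proof. by move=> a a' b; apply: (malg_liftD (gmul_fam2 b)). Qed.

Lemma gmulDr : right_distributive gmul +%R.
Proof.
move=> a b b'; rewrite /gmul -malg_liftDf; apply: eq_malg_lift => x c.
exact: (malg_liftD (gmul_fam1 x c)).
Qed.

Lemma gmulUU c d x y : gmul (gelt c x) (gelt d y) = gelt (c * d) (x + y).
Proof.
rewrite /gmul (malg_liftU _ _ (gmul_fam2 _)).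
exact: (malg_liftU _ _ (gmul_fam1 _ _)).
Qed.

Lemma gmul0 a : gmul a 0 = 0.
Proof. by apply: (addIr (gmul a 0)); rewrite -gmulDr !add0r. Qed.

Lemma g0mul a : gmul 0 a = 0.
Proof. by apply: (addIr (gmul 0 a)); rewrite -gmulDl !add0r. Qed.

Lemma gmulC : commutative gmul.
Proof.
move=> a b; elim/galg_ind: a => [|c x|a a' IH IH'].
- by rewrite gmul0 g0mul.
- elim/galg_ind: b => [|d y|b b' IH IH']; first by rewrite gmul0 g0mul.
  + by rewrite !gmulUU mulrC addrC.
  + by rewrite gmulDl gmulDr IH IH'.
- by rewrite gmulDl gmulDr IH IH'.
Qed.

Lemma gmulA : associative gmul.
Proof.
move=> a b e; elim/galg_ind: a => [|c x|a a' IH IH']; first by rewrite !g0mul.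
  elim/galg_ind: b => [|d y|b b' IH IH']; first by rewrite !(gmul0, g0mul).
    elim/galg_ind: e => [|f z|e e' IH IH']; first by rewrite !gmul0.
      by rewrite !gmulUU mulrA addrA.
    by rewrite !gmulDr IH IH'.
  by rewrite !(gmulDl, gmulDr) IH IH'.
by rewrite !gmulDl IH IH'.
Qed.

Lemma gmul1 : left_id gone gmul.
Proof.
elim/galg_ind => [|c x|a a' IH IH']; first by rewrite gmul0.
  by rewrite gmulUU mul1r add0r.
by rewrite gmulDr IH IH'.
Qed.

HB.instance Definition _ := GRing.Zmodule_isComPzRing.Build KG
  gmulA gmulC gmul1 gmulDl.

Lemma scale_gelt (M : lmodType KG) c d x y (m : M) :
  gelt c x *: (gelt d y *: m) = gelt (c * d) (x + y) *: m.
Proof. by rewrite scalerA; congr (_ *: m); apply: gmulUU. Qed.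

End GroupAlgebra.

Section TensorRelations.
Variables (R : comPzRingType) (M N : lmodType R).

(* The subgroup of the free abelian group on M * N spanned by the relations of
   bilinearity. *)
Inductive tens_rel : {malg int[(M * N)%type]} -> Prop :=
| tens_relDl m m' n : tens_rel (<< (m + m', n) >> - << (m, n) >> - << (m', n) >>)
| tens_relDr m n n' : tens_rel (<< (m, n + n') >> - << (m, n) >> - << (m, n') >>)
| tens_relZ a m n : tens_rel (<< (a *: m, n) >> - << (m, a *: n) >>)
| tens_rel0 : tens_rel 0
| tens_relB u v : tens_rel u -> tens_rel v -> tens_rel (u - v).

Definition tens_relb : {pred {malg int[(M * N)%type]}} := fun u => `[< tens_rel u >].

Fact tens_rel_zmod_closed : zmod_closed tens_relb.
Proof.
split=> [|u v /asboolP ru /asboolP rv]; apply/asboolP; first exact: tens_rel0.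
exact: tens_relB.
Qed.

HB.instance Definition _ :=
  GRing.isZmodClosed.Build {malg int[(M * N)%type]} tens_relb tens_rel_zmod_closed.

End TensorRelations.

Definition tensor (R : comPzRingType) (M N : lmodType R) : Type :=
  {quot (@tens_relb R M N)}.

HB.instance Definition _ (R : comPzRingType) (M N : lmodType R) :=
  GRing.Zmodule.copy (tensor M N) {quot (@tens_relb R M N)}.

HB.lock Definition pure (R : comPzRingType) (M N : lmodType R) (m : M) (n : N)
  : tensor M N := \pi_{quot (@tens_relb R M N)} << (m, n) >>.
Arguments pure {R M N} m n.

Definition free_lift (R : comPzRingType) (M N : lmodType R) (V : zmodType)
    (f : M -> N -> V) : {malg int[(M * N)%type]} -> V :=
  malg_lift (fun p k => f p.1 p.2 *~ k).

(* Meaningful only when f is biadditive and balanced, see tliftE. *)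
HB.lock Definition tlift (R : comPzRingType) (M N : lmodType R) (V : zmodType)
    (f : M -> N -> V) (t : tensor M N) : V :=
  free_lift f (repr (t : {quot (@tens_relb R M N)})).
Arguments tlift {R M N V} f t.

Section TensorTheory.
Variables (R : comPzRingType) (M N : lmodType R).
Local Notation F := {malg int[(M * N)%type]}.
Local Notation Q := {quot (@tens_relb R M N)}.

Definition balanced (V : zmodType) (f : M -> N -> V) := [/\
  forall m m' n, f (m + m') n = f m n + f m' n,
  forall m n n', f m (n + n') = f m n + f m n' &
  forall a m n, f (a *: m) n = f m (a *: n)].

Lemma pi_eqP (u v : F) : tens_rel (u - v) -> \pi_Q u = \pi_Q v.
Proof. by move=> r; apply/eqmodP; rewrite /= equivE; apply/asboolP. Qed.

Lemma pi_eqV (u v : F) : \pi_Q u = \pi_Q v -> tens_rel (u - v).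
Proof. by move/eqmodP; rewrite /= equivE => /asboolP. Qed.

Lemma pureDl (m m' : M) (n : N) : pure (m + m') n = pure m n + pure m' n.
Proof.
rewrite pure.unlock -[RHS](raddfD (\pi_Q)); apply: pi_eqP.
by rewrite opprD addrA; apply: tens_relDl.
Qed.

Lemma pureDr (m : M) (n n' : N) : pure m (n + n') = pure m n + pure m n'.
Proof.
rewrite pure.unlock -[RHS](raddfD (\pi_Q)); apply: pi_eqP.
by rewrite opprD addrA; apply: tens_relDr.
Qed.

Lemma pureZ a (m : M) (n : N) : pure (a *: m) n = pure m (a *: n).
Proof. by rewrite pure.unlock; apply: pi_eqP; apply: tens_relZ. Qed.

Lemma pure_balanced : balanced (@pure R M N).
Proof. by split; [apply: pureDl | apply: pureDr | apply: pureZ]. Qed.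

Lemma pure0l (n : N) : pure (0 : M) n = 0.
Proof. by apply: (addIr (pure (0 : M) n)); rewrite -pureDl !add0r. Qed.

Lemma pure0r (m : M) : pure m (0 : N) = 0.
Proof. by apply: (addIr (pure m (0 : N))); rewrite -pureDr !add0r. Qed.

Lemma pureNl (m : M) (n : N) : pure (- m) n = - pure m n.
Proof. by apply: (addIr (pure m n)); rewrite -pureDl !addNr pure0l. Qed.

Lemma tensor_ind (P : tensor M N -> Prop) :
  P 0 -> (forall (m : M) (n : N), P (pure m n)) -> (forall t u, P t -> P u -> P (t + u)) ->
  forall t, P t.
Proof.
move=> P0 Pp PD t; rewrite -[t](@reprK _ Q).
elim/malg_ind: (repr _) => [|[m n] k|u v Pu Pv].
- by rewrite (raddf0 (\pi_Q)).
- have Pn (j : nat) (m' : M) : P (pure m' n *+ j).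
    by elim: j => [|j IHj]; rewrite ?mulr0n // mulrS; apply: PD.
  have -> : \pi_Q << k *g (m, n) >> = pure m n *~ k.
    by rewrite monalgUz (raddfMz (\pi_Q)) pure.unlock.
  case: k => j; first exact: Pn.
  by rewrite NegzE mulrNz -[X in P (- X)]/(pure m n *+ j.+1) -mulNrn -pureNl; apply: Pn.
- by rewrite (raddfD (\pi_Q)); apply: PD.
Qed.

Section Lift.
Variables (V : zmodType) (f : M -> N -> V).
Hypothesis fbal : balanced f.

Fact free_lift_fam : additive_family (fun p k => f p.1 p.2 *~ k : V).
Proof. by move=> p k k'; rewrite mulrzDr. Qed.

Lemma free_liftD : {morph free_lift f : u v / u + v}.
Proof. exact: malg_liftD free_lift_fam. Qed.

Lemma free_lift0 : free_lift f 0 = 0.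
Proof. by apply: (addIr (free_lift f 0)); rewrite -free_liftD !add0r. Qed.

Lemma free_liftN u : free_lift f (- u) = - free_lift f u.
Proof. by apply: (addIr (free_lift f u)); rewrite -free_liftD !addNr free_lift0. Qed.

Lemma free_liftU p : free_lift f << p >> = f p.1 p.2.
Proof. by rewrite /free_lift (malg_liftU _ _ free_lift_fam) mulr1z. Qed.

Lemma free_lift_rel u : tens_rel u -> free_lift f u = 0.
Proof.
have [fDl fDr fZ] := fbal.
elim=> [m m' n|m n n'|a m n||v w _ IHv _ IHw].
- by rewrite !free_liftD !free_liftN !free_liftU /= fDl addrAC addrK subrr.
- by rewrite !free_liftD !free_liftN !free_liftU /= fDr addrAC addrK subrr.
- by rewrite free_liftD free_liftN !free_liftU /= fZ subrr.
- exact: free_lift0.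
- by rewrite free_liftD free_liftN IHv IHw subrr.
Qed.

Lemma tlift_pi (u : F) : tlift f (\pi_Q u : tensor M N) = free_lift f u.
Proof.
rewrite tlift.unlock; apply/eqP; rewrite -subr_eq0 -free_liftN -free_liftD; apply/eqP.
by apply/free_lift_rel/pi_eqV; rewrite reprK.
Qed.

Lemma tliftE m n : tlift f (pure m n) = f m n.
Proof. by rewrite pure.unlock tlift_pi free_liftU. Qed.

Lemma tliftD : {morph tlift f : t u / t + u}.
Proof.
move=> t u; rewrite -[t](@reprK _ Q) -[u](@reprK _ Q).
by rewrite -(raddfD (\pi_Q)) !tlift_pi free_liftD.
Qed.

Lemma tlift0 : tlift f 0 = 0.
Proof. by apply: (addIr (tlift f 0)); rewrite -tliftD !add0r. Qed.

End Lift.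

Definition tscale (a : R) (t : tensor M N) : tensor M N :=
  tlift (fun m n => pure (a *: m) n) t.

Fact tscale_bal a : balanced (fun m n => pure (a *: m) n).
Proof.
split=> [m m' n|m n n'|b m n]; first by rewrite scalerDr pureDl.
  by rewrite pureDr.
by rewrite -pureZ !scalerA mulrC.
Qed.

Lemma tscaleE a m n : tscale a (pure m n) = pure (a *: m) n.
Proof. exact: (tliftE (tscale_bal a)). Qed.

Lemma tscalerDr : right_distributive tscale +%R.
Proof. by move=> a; apply: (tliftD (tscale_bal a)). Qed.

Lemma tscaler0 a : tscale a 0 = 0.
Proof. exact: (tlift0 (tscale_bal a)). Qed.

Lemma tscalerDl t : {morph tscale^~ t : a b / a + b}.
Proof.
move=> a b; elim/tensor_ind: t => [|m n|t u IHt IHu] /=.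
- by rewrite !tscaler0 addr0.
- by rewrite !tscaleE scalerDl pureDl.
- by rewrite !tscalerDr IHt IHu addrACA.
Qed.

Lemma tscalerA a b t : tscale a (tscale b t) = tscale (a * b) t.
Proof.
elim/tensor_ind: t => [|m n|t u IHt IHu]; first by rewrite !tscaler0.
  by rewrite !tscaleE scalerA.
by rewrite !tscalerDr IHt IHu.
Qed.

Lemma tscale1r : left_id 1 tscale.
Proof.
elim/tensor_ind => [|m n|t u IHt IHu]; first by rewrite tscaler0.
  by rewrite tscaleE scale1r.
by rewrite tscalerDr IHt IHu.
Qed.

HB.instance Definition _ := GRing.Zmodule_isLmodule.Build R (tensor M N)
  tscalerA tscale1r tscalerDr tscalerDl.

Lemma scale_pure a m n : a *: pure m n = pure (a *: m) n.
Proof. exact: tscaleE. Qed.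

End TensorTheory.

Record calg (R : comPzRingType) := CAlg {
  calg_mod :> lmodType R;
  cmul : calg_mod -> calg_mod -> calg_mod;
  cmulA : associative cmul;
  cmulC : commutative cmul;
  cmulDl : left_distributive cmul +%R;
  cmulZl : forall (a : R) s s', cmul (a *: s) s' = a *: cmul s s'
}.

Arguments cmul {R c} s s'.

Section CAlgTheory.
Variables (R : comPzRingType) (A : calg R).
Implicit Types s : A.

Lemma cmulDr : right_distributive (@cmul R A) +%R.
Proof. by move=> s s' s''; rewrite !(cmulC s) cmulDl. Qed.

Lemma cmulZr (a : R) s s' : cmul s (a *: s') = a *: cmul s s'.
Proof. by rewrite !(cmulC s) cmulZl. Qed.

End CAlgTheory.

Section TensorAlgebra.
Variables (R : comPzRingType) (A B : calg R).
Local Notation AB := (tensor A B).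

Definition tmul (t u : AB) : AB :=
  tlift (fun a b => tlift (fun a' b' => pure (cmul a a') (cmul b b')) u) t.

Fact tmul_bal1 (a : A) (b : B) :
  balanced (fun a' b' => pure (cmul a a') (cmul b b')).
Proof.
split=> [m m' n|m n n'|c m n]; first by rewrite cmulDr pureDl.
  by rewrite cmulDr pureDr.
by rewrite !cmulZr pureZ.
Qed.

Let mulp (a : A) (b : B) : AB -> AB :=
  tlift (fun a' b' => pure (cmul a a') (cmul b b')).

Fact mulpE a b a' b' : mulp a b (pure a' b') = pure (cmul a a') (cmul b b').
Proof. exact: (tliftE (tmul_bal1 a b)). Qed.

Fact mulpD a b : {morph mulp a b : t u / t + u}.
Proof. exact: (tliftD (tmul_bal1 a b)). Qed.

Fact mulp0 a b : mulp a b 0 = 0.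
Proof. exact: (tlift0 (tmul_bal1 a b)). Qed.

Fact tmul_bal2 (u : AB) : balanced (fun a b => mulp a b u).
Proof.
elim/tensor_ind: u => [|a b|t u [tD tD' tZ] [uD uD' uZ]].
- by split=> *; rewrite !mulp0 ?addr0.
- split=> [m m' n|m n n'|c m n]; rewrite !mulpE.
  + by rewrite cmulDl pureDl.
  + by rewrite cmulDl pureDr.
  + by rewrite !cmulZl pureZ.
- split=> [m m' n|m n n'|c m n]; rewrite !mulpD.
  + by rewrite tD uD addrACA.
  + by rewrite tD' uD' addrACA.
  + by rewrite tZ uZ.
Qed.

Lemma tmul_pure a b a' b' :
  tmul (pure a b) (pure a' b') = pure (cmul a a') (cmul b b').
Proof. by rewrite /tmul (tliftE (tmul_bal2 _)) -[LHS]/(mulp _ _ _) mulpE. Qed.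

Lemma tmulDl : left_distributive tmul +%R.
Proof. by move=> t t' u; apply: (tliftD (tmul_bal2 u)). Qed.

Lemma t0mul u : tmul 0 u = 0.
Proof. exact: (tlift0 (tmul_bal2 u)). Qed.

Lemma tmulDr : right_distributive tmul +%R.
Proof.
move=> t u u'; elim/tensor_ind: t => [|a b|t t' IH IH'].
- by rewrite !t0mul addr0.
- by rewrite /tmul !(tliftE (tmul_bal2 _)); apply: mulpD.
- by rewrite !tmulDl IH IH' addrACA.
Qed.

Lemma tmul0 t : tmul t 0 = 0.
Proof. by apply: (addIr (tmul t 0)); rewrite -tmulDr !add0r. Qed.

Lemma tmulC : commutative tmul.
Proof.
move=> t u; elim/tensor_ind: t => [|a b|t t' IH IH'].
- by rewrite tmul0 t0mul.
- elim/tensor_ind: u => [|a' b'|u u' IH IH']; first by rewrite tmul0 t0mul.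
    by rewrite !tmul_pure (cmulC a) (cmulC b).
  by rewrite tmulDl tmulDr IH IH'.
- by rewrite tmulDl tmulDr IH IH'.
Qed.

Lemma tmulA : associative tmul.
Proof.
move=> t u v; elim/tensor_ind: t => [|a b|t t' IH IH'].
- by rewrite !t0mul.
- elim/tensor_ind: u => [|a' b'|u u' IH IH']; first by rewrite !(tmul0, t0mul).
    elim/tensor_ind: v => [|a'' b''|v v' IH IH']; first by rewrite !tmul0.
      by rewrite !tmul_pure !cmulA.
    by rewrite !tmulDr IH IH'.
  by rewrite !(tmulDl, tmulDr) IH IH'.
- by rewrite !tmulDl IH IH'.
Qed.

Lemma tmulZl (c : R) t u : tmul (c *: t) u = c *: tmul t u.
Proof.
elim/tensor_ind: t => [|a b|t t' IH IH'].
- by rewrite scaler0 t0mul scaler0.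
- elim/tensor_ind: u => [|a' b'|u u' IH IH']; first by rewrite !tmul0 scaler0.
    by rewrite scale_pure !tmul_pure scale_pure cmulZl.
  by rewrite !tmulDr IH IH' scalerDr.
- by rewrite scalerDr !tmulDl IH IH' scalerDr.
Qed.

Definition talg : calg R := CAlg tmulA tmulC tmulDl tmulZl.

End TensorAlgebra.

HB.mixin Record Group_isAbelian T of Group T := {
  mulTC : forall c d : T, (c * d = d * c)%g
}.

#[short(type="abGroupType")]
HB.structure Definition AbGroup := {T of Group T & Group_isAbelian T}.

(* pairing xi x is the element <xi|x>. *)
Record duality (Gam G : zmodType) (T : abGroupType) := Duality {
  pairing :> Gam -> G -> T;
  pairingDl : forall xi eta x,
    pairing (xi + eta) x = (pairing xi x * pairing eta x)%g;
  pairingDr : forall xi x y,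
    pairing xi (x + y) = (pairing xi x * pairing xi y)%g;
  pairing_injl : injective pairing;
  pairing_injr : injective (fun x xi => pairing xi x)
}.

(* By uchar_unit the values lie in the group of units of K. *)
Record unit_char (T : abGroupType) (K : comPzRingType) := UnitChar {
  uchar :> T -> K;
  uchar_unit : forall c, exists k : K, k * uchar c = 1;
  ucharM : forall c d, uchar (c * d)%g = uchar c * uchar d
}.

Section HeisenbergGroup.
Variables (Gam G : zmodType) (T : abGroupType).

(* Heis c x xi is the element c (x, xi) of H(beta). *)
Record heis (beta : duality Gam G T) := Heis { hT : T; hG : G; hGam : Gam }.

Variable beta : duality Gam G T.
Local Notation H := (heis beta).

Fact heis_prodK :
  cancel (fun h : H => (hT h, hG h, hGam h)) (fun p => Heis beta p.1.1 p.1.2 p.2).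
Proof. by case. Qed.

HB.instance Definition _ := Choice.copy H (can_type heis_prodK).

Definition heis_one : H := Heis beta 1%g 0 0.
Definition heis_mul (h k : H) : H :=
  Heis beta (hT h * hT k * beta (hGam h) (hG k))%g (hG h + hG k)
    (hGam h + hGam k).
Definition heis_inv (h : H) : H :=
  Heis beta ((hT h)^-1 * beta (hGam h) (hG h))%g (- hG h) (- hGam h).

Lemma pairing0l x : beta 0 x = 1%g.
Proof. by apply: (mulIg (beta 0 x)); rewrite -pairingDl addr0 mul1g. Qed.

Lemma pairing0r xi : beta xi 0 = 1%g.
Proof. by apply: (mulIg (beta xi 0)); rewrite -pairingDr addr0 mul1g. Qed.

Lemma pairingNr xi x : beta xi (- x) = (beta xi x)^-1%g.
Proof. by apply: (mulIg (beta xi x)); rewrite -pairingDr addNr pairing0r mulVg. Qed.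

Lemma pairingNl xi x : beta (- xi) x = (beta xi x)^-1%g.
Proof. by apply: (mulIg (beta xi x)); rewrite -pairingDl addNr pairing0l mulVg. Qed.

Fact heis_mulA : associative heis_mul.
Proof.
move=> [a x xi] [b y eta] [c z zeta]; rewrite /heis_mul /= !addrA.
congr Heis; rewrite pairingDl pairingDr -!mulgA; congr (a * (b * _))%g.
move: (beta eta z) (beta xi y) (beta xi z) => e p q.
by rewrite (mulTC e) !mulgA (mulTC c p).
Qed.

Fact heis_mul1 : left_id heis_one heis_mul.
Proof.
move=> [a x xi]; rewrite /heis_mul /= !add0r pairing0l mulg1 mul1g //.
Qed.

Fact heis_mulr1 : right_id heis_one heis_mul.
Proof. by move=> [a x xi]; rewrite /heis_mul /= !addr0 pairing0r !mulg1. Qed.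

Fact heis_mulV : left_inverse heis_one heis_inv heis_mul.
Proof.
move=> [a x xi]; rewrite /heis_mul /= !addNr pairingNl.
by rewrite -(mulgA a^-1%g) (mulTC _ a) mulgA mulVg mul1g mulgV.
Qed.

Fact heis_mulrV : right_inverse heis_one heis_inv heis_mul.
Proof.
move=> [a x xi]; rewrite /heis_mul /= !addrN pairingNr.
by rewrite mulgA mulgV mul1g mulgV.
Qed.

HB.instance Definition _ := isGroup.Build H
  heis_mulA heis_mul1 heis_mulr1 heis_mulV heis_mulrV.

Definition heisT (c : T) : H := Heis beta c 0 0.
Definition heisG (x : G) : H := Heis beta 1%g x 0.
Definition heisGam (xi : Gam) : H := Heis beta 1%g 0 xi.

End HeisenbergGroup.

Record heis_alg (Gam G : zmodType) (T : abGroupType) (K : comPzRingType)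
    (beta : duality Gam G T) (eps : unit_char T K) := HeisAlg {
  ha_alg :> calg K;
  hact : heis beta -> ha_alg -> ha_alg;
  hact1 : forall s, hact 1%g s = s;
  hactM : forall h k s, hact (h * k)%g s = hact h (hact k s);
  hact_linear : forall h, linear (hact h);
  hact_T : forall c s, hact (heisT beta c) s = eps c *: s;
  hact_G : forall x s s',
    hact (heisG beta x) (cmul s s') = cmul (hact (heisG beta x) s) s';
  hact_Gam : forall xi s s', hact (heisGam beta xi) (cmul s s') =
    cmul (hact (heisGam beta xi) s) (hact (heisGam beta xi) s')
}.

Section HeisAlgTheory.
Variables (Gam G : zmodType) (T : abGroupType) (K : comPzRingType).
Variables (beta : duality Gam G T) (eps : unit_char T K).
Local Notation KG := (group_alg K G).
Implicit Types S : heis_alg beta eps.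

Record heis_hom S S' := HeisHom {
  hfun :> S -> S';
  hfun_linear : linear hfun;
  hfunM : forall s s', hfun (cmul s s') = cmul (hfun s) (hfun s');
  hfun_act : forall h s, hfun (hact h s) = hact h (hfun s)
}.

Lemma heis_homP S S' (f g : heis_hom S S') : hfun f = hfun g -> f = g.
Proof.
case: f g => [f fl fM fa] [g gl gM ga] /= eqfg; case: _ / eqfg in gl gM ga *.
by congr HeisHom; apply: Prop_irrelevance.
Qed.

Definition heis_id S : heis_hom S S :=
  @HeisHom S S id (fun a u v => erefl) (fun s s' => erefl) (fun h s => erefl).

Fact heis_comp_linear S S' S'' (g : heis_hom S' S'') (f : heis_hom S S') :
  linear (g \o f).
Proof. by move=> a u v /=; rewrite !hfun_linear. Qed.

Fact heis_compM S S' S'' (g : heis_hom S' S'') (f : heis_hom S S') s s' :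
  (g \o f) (cmul s s') = cmul ((g \o f) s) ((g \o f) s').
Proof. by rewrite /= !hfunM. Qed.

Fact heis_comp_act S S' S'' (g : heis_hom S' S'') (f : heis_hom S S') h s :
  (g \o f) (hact h s) = hact h ((g \o f) s).
Proof. by rewrite /= !hfun_act. Qed.

Definition heis_comp S S' S'' (g : heis_hom S' S'') (f : heis_hom S S') :
    heis_hom S S'' :=
  HeisHom (heis_comp_linear g f) (heis_compM g f) (heis_comp_act g f).

Fact heis_comp1m S S' (f : heis_hom S S') : heis_comp (heis_id S') f = f.
Proof. exact: heis_homP. Qed.

Fact heis_compm1 S S' (f : heis_hom S S') : heis_comp f (heis_id S) = f.
Proof. exact: heis_homP. Qed.

Fact heis_compmA S S' S'' S3 (h : heis_hom S'' S3) (g : heis_hom S' S'')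
    (f : heis_hom S S') :
  heis_comp h (heis_comp g f) = heis_comp (heis_comp h g) f.
Proof. exact: heis_homP. Qed.

Definition AlgH : category := Category heis_comp1m heis_compm1 heis_compmA.

Definition KGmod S : Type := S.

Section KGAlgebra.
Variable S : heis_alg beta eps.

Lemma hactD h : {morph (@hact _ _ _ _ _ _ S h) : s s' / s + s'}.
Proof. by move=> s s'; rewrite -[s]scale1r hact_linear !scale1r. Qed.

Lemma hact0 h : hact h (0 : S) = 0.
Proof. by apply: (addIr (hact h 0)); rewrite -hactD !add0r. Qed.

Lemma hactZ h a (s : S) : hact h (a *: s) = a *: hact h s.
Proof. by rewrite -[a *: s]addr0 hact_linear hact0 addr0. Qed.

Lemma heisGD x y : (heisG beta x * heisG beta y)%g = heisG beta (x + y).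
Proof.
by rewrite -[LHS]/(heis_mul _ _) /heis_mul /= pairing0l addr0 !mulg1.
Qed.

HB.instance Definition _ := GRing.Zmodule.copy (KGmod S) (ha_alg S).

Definition KGscale (a : KG) (s : KGmod S) : KGmod S :=
  malg_lift (fun x c => c *: hact (heisG beta x) (s : S)) a.

Fact KGscale_fam (s : S) :
  additive_family (fun x (c : K) => c *: hact (heisG beta x) s).
Proof. by move=> x c d; rewrite scalerDl. Qed.

Lemma KGscaleU c x s : KGscale (gelt c x) s = c *: hact (heisG beta x) (s : S).
Proof. exact: (malg_liftU _ _ (KGscale_fam s)). Qed.

Lemma KGscalerDl s : {morph KGscale^~ s : a b / a + b}.
Proof. exact: (malg_liftD (KGscale_fam s)). Qed.

Lemma KGscalerDr : right_distributive KGscale +%R.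
Proof.
move=> a s s'; rewrite /KGscale -malg_liftDf; apply: eq_malg_lift => x c.
by rewrite hactD scalerDr.
Qed.

Lemma KGscale0r s : KGscale 0 s = 0.
Proof. by apply: (addIr (KGscale 0 s)); rewrite -KGscalerDl !add0r. Qed.

Lemma KGscaler0 a : KGscale a 0 = 0.
Proof. by apply: (addIr (KGscale a 0)); rewrite -KGscalerDr !add0r. Qed.

Lemma KGscalerA a b s : KGscale a (KGscale b s) = KGscale (a * b) s.
Proof.
elim/galg_ind: a => [|c x|a a' IH IH']; first by rewrite mul0r !KGscale0r.
  elim/galg_ind: b => [|d y|b b' IH IH'].
  - by rewrite mulr0 !KGscale0r KGscaler0.
  - rewrite -[gelt c x * _]/(gmul _ _) gmulUU !KGscaleU hactZ -hactM heisGD.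
    by rewrite scalerA.
  - by rewrite mulrDr !KGscalerDl KGscalerDr IH IH'.
by rewrite mulrDl !KGscalerDl IH IH'.
Qed.

Lemma KGscale1r : left_id 1 KGscale.
Proof.
by move=> s; rewrite -[1]/(gelt 1 0) KGscaleU scale1r; apply: hact1.
Qed.

HB.instance Definition _ := GRing.Zmodule_isLmodule.Build KG (KGmod S)
  KGscalerA KGscale1r KGscalerDr KGscalerDl.

Definition KGcmul (s s' : KGmod S) : KGmod S := cmul (s : S) s'.

Lemma KGcmulZl (a : KG) s s' : KGcmul (a *: s) s' = a *: KGcmul s s'.
Proof.
have c0 (u : S) : cmul 0 u = 0.
  by apply: (addIr (cmul 0 u)); rewrite -cmulDl !add0r.
elim/galg_ind: a => [|c x|a a' IH IH']; first by rewrite !scale0r; apply: c0.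
  rewrite -![gelt c x *: _]/(KGscale _ _) !KGscaleU /KGcmul.
  by rewrite cmulZl hact_G.
by rewrite !scalerDl -IH -IH'; apply: cmulDl.
Qed.

Definition KGalg : calg KG :=
  @CAlg KG (KGmod S) KGcmul (@cmulA K S) (@cmulC K S) (@cmulDl K S) KGcmulZl.

End KGAlgebra.

(* Restriction of scalars along K -> KG. *)
Definition Kmod (M : lmodType KG) : Type := M.

Section Restriction.
Variable M : lmodType KG.

HB.instance Definition _ := GRing.Zmodule.copy (Kmod M) M.

Definition Kscale (c : K) (m : Kmod M) : Kmod M := gelt c (0 : G) *: (m : M).

Fact KscalerA a b m : Kscale a (Kscale b m) = Kscale (a * b) m.
Proof.
by rewrite /Kscale scale_gelt addr0.
Qed.

Fact Kscale1r : left_id 1 Kscale.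
Proof. exact: (@scale1r KG M). Qed.

Fact KscalerDr : right_distributive Kscale +%R.
Proof. by move=> a; apply: (@scalerDr KG M). Qed.

Fact KscalerDl m : {morph Kscale^~ m : a b / a + b}.
Proof. by move=> a b; rewrite /Kscale geltD (@scalerDl KG M). Qed.

HB.instance Definition _ := GRing.Zmodule_isLmodule.Build K (Kmod M)
  KscalerA Kscale1r KscalerDr KscalerDl.

End Restriction.

Section RestrictionAlg.
Variable A : calg KG.

Definition Kcmul (s s' : Kmod A) : Kmod A := cmul (s : A) s'.

Fact KcmulZl (a : K) s s' : Kcmul (a *: s) s' = a *: Kcmul s s'.
Proof. exact: (@cmulZl KG A). Qed.

Definition Kalg : calg K :=
  @CAlg K (Kmod A) Kcmul (@cmulA KG A) (@cmulC KG A) (@cmulDl KG A) KcmulZl.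

End RestrictionAlg.

Section HeisTensor.
Variables S S' : heis_alg beta eps.
Local Notation SS' := (tensor (KGalg S) (KGalg S')).

Definition tgam (xi : Gam) (t : SS') : SS' :=
  tlift (fun (s : KGalg S) (s' : KGalg S') =>
    pure (hact (heisGam beta xi) (s : S) : KGalg S)
         (hact (heisGam beta xi) (s' : S') : KGalg S')) t.

Lemma uchar1 : eps 1%g = 1.
Proof.
have [k k1] := uchar_unit eps 1%g.
by rewrite -[LHS]mul1r -k1 -mulrA -ucharM mulg1.
Qed.

Lemma heisGamG xi x : (heisGam beta xi * heisG beta x)%g =
  (heisT beta (beta xi x) * (heisG beta x * heisGam beta xi))%g.
Proof.
rewrite -[LHS]/(heis_mul _ _) -[RHS]/(heis_mul _ (heis_mul _ _)) /heis_mul /=.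
by rewrite !pairing0l !mulg1 !mul1g !addr0 !add0r.
Qed.

Lemma heisGamD xi eta : (heisGam beta xi * heisGam beta eta)%g =
  heisGam beta (xi + eta).
Proof.
by rewrite -[LHS]/(heis_mul _ _) /heis_mul /= pairing0r addr0 !mulg1.
Qed.

Lemma hact_gelt (W : heis_alg beta eps) xi c x (s : KGmod W) :
  hact (heisGam beta xi) (gelt c x *: s : W) =
  gelt (c * eps (beta xi x)) x *: (hact (heisGam beta xi) (s : W) : KGmod W).
Proof.
rewrite -![gelt _ _ *: _]/(KGscale _ _) !KGscaleU hactZ -!hactM heisGamG.
by rewrite hactM hact_T scalerA.
Qed.

Fact tgam_bal xi : balanced (fun (s : KGalg S) (s' : KGalg S') =>
  pure (hact (heisGam beta xi) (s : S) : KGalg S)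
       (hact (heisGam beta xi) (s' : S') : KGalg S')).
Proof.
split=> [s s1 s'|s s' s1'|a s s'].
- by rewrite hactD pureDl.
- by rewrite hactD pureDr.
elim/galg_ind: a => [|c x|a a' IH IH'].
- by rewrite !scale0r !hact0 pure0l pure0r.
- by rewrite !hact_gelt pureZ.
- by rewrite !scalerDl !hactD pureDl pureDr IH IH'.
Qed.

Lemma tgamE xi s s' : tgam xi (pure s s') =
  pure (hact (heisGam beta xi) (s : S) : KGalg S)
       (hact (heisGam beta xi) (s' : S') : KGalg S').
Proof. exact: (tliftE (tgam_bal xi)). Qed.

Lemma tgamD xi : {morph tgam xi : t u / t + u}.
Proof. exact: (tliftD (tgam_bal xi)). Qed.

Lemma tgam0 xi : tgam xi 0 = 0.
Proof. exact: (tlift0 (tgam_bal xi)). Qed.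

Lemma tgamZ xi c x t :
  tgam xi (gelt c x *: t) = gelt (c * eps (beta xi x)) x *: tgam xi t.
Proof.
elim/tensor_ind: t => [|s s'|t u IHt IHu].
- by rewrite !(scaler0, tgam0).
- by rewrite scale_pure !tgamE scale_pure hact_gelt.
- by rewrite scalerDr !tgamD IHt IHu scalerDr.
Qed.

Lemma tgam_0 t : tgam 0 t = t.
Proof.
elim/tensor_ind: t => [|s s'|t u IHt IHu]; first by rewrite tgam0.
  by rewrite tgamE !hact1.
by rewrite tgamD IHt IHu.
Qed.

Lemma tgam_add xi eta t : tgam (xi + eta) t = tgam xi (tgam eta t).
Proof.
elim/tensor_ind: t => [|s s'|t u IHt IHu]; first by rewrite !tgam0.
  by rewrite !tgamE -heisGamD !hactM.
by rewrite !tgamD IHt IHu.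
Qed.

Lemma tgamM xi t u : tgam xi (tmul t u) = tmul (tgam xi t) (tgam xi u).
Proof.
elim/tensor_ind: t => [|s s'|t t' IH IH'].
- by rewrite !(t0mul, tgam0).
- elim/tensor_ind: u => [|s1 s1'|u u' IH IH']; first by rewrite !(tmul0, tgam0).
    by rewrite tmul_pure !tgamE tmul_pure -!hact_Gam.
  by rewrite !(tmulDr, tgamD) IH IH'.
- by rewrite !(tmulDl, tgamD) IH IH'.
Qed.

(* c (x, xi) = c . (x, 0) . (0, xi), where c and x act through KG. *)
Definition thact (h : heis beta) (t : Kalg (talg (KGalg S) (KGalg S'))) :
    Kalg (talg (KGalg S) (KGalg S')) :=
  gelt (eps (hT h)) (hG h) *: tgam (hGam h) t.

Fact thact1 t : thact 1%g t = t.
Proof. by rewrite /thact /= uchar1 tgam_0; apply: (@scale1r KG). Qed.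

Fact thactM h k t : thact (h * k)%g t = thact h (thact k t).
Proof.
rewrite /thact tgam_add tgamZ (scale_gelt (M := SS')) /=.
by rewrite !ucharM -!mulrA (mulrC (eps (hT k))).
Qed.

Fact thact_linear h : linear (thact h).
Proof.
move=> a t u; rewrite /thact tgamD scalerDr tgamZ pairing0r uchar1 mulr1.
congr (_ + _).
rewrite -[RHS]/(gelt a 0 *: (_ : SS')) !(scale_gelt (M := SS')).
by rewrite mulrC addrC.
Qed.

Fact thact_T c t : thact (heisT beta c) t = eps c *: t.
Proof. by rewrite /thact /= tgam_0. Qed.

Fact thact_G x t u :
  thact (heisG beta x) (cmul t u) = cmul (thact (heisG beta x) t) u.
Proof. by rewrite /thact /= !tgam_0; rewrite -[RHS]/(tmul _ _) tmulZl. Qed.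

Fact thact_Gam xi t u : thact (heisGam beta xi) (cmul t u) =
  cmul (thact (heisGam beta xi) t) (thact (heisGam beta xi) u).
Proof.
rewrite /thact /= uchar1 -[gelt 1 0]/(1 : KG) !(@scale1r KG); exact: tgamM.
Qed.

Definition htens : heis_alg beta eps :=
  HeisAlg thact1 thactM thact_linear thact_T thact_G thact_Gam.

Definition hpure (s : S) (s' : S') : htens :=
  pure (s : KGalg S) (s' : KGalg S').

End HeisTensor.
End HeisAlgTheory.

(* Main.v *)
(* A map between Heisenberg algebras is a morphism iff it is KG-linear,
   multiplicative and Gam-equivariant, so the structure maps are those of
   modules over KG, obtained from the universal property of the tensor product,
   and the coherence laws hold because they hold on pure tensors.  The unit is
   KG itself, where xi in Gam maps x in G to <xi|x> x.  The inverse of the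
   associator and the right unitor are composites with the braiding. *)
Require Import Defs.
From mathcomp Require Import all_boot all_algebra.
From mathcomp Require Import boolp.
From mathcomp.multinomials Require Import monalg.

Set Implicit Arguments.
Unset Strict Implicit.
Unset Printing Implicit Defensive.

Import GRing.Theory.
Local Open Scope ring_scope.

Section HeisenbergMonoidal.
Variables (Gam G : zmodType) (T : abGroupType) (K : comPzRingType).
Variables (beta : duality Gam G T) (eps : unit_char T K).
Local Notation KG := (group_alg K G).
Local Notation HA := (heis_alg beta eps).
Local Notation "S ** S'" := (@htens Gam G T K beta eps S S')
  (at level 40, left associativity).
Implicit Types (S A B D E : HA) (xi : Gam) (a : KG).

(** * The actions of KG and of Gam on a Heisenberg algebra *)

Definition gscale S a (s : S) : S := KGscale a (s : KGmod S).
Definition gam S xi (s : S) : S := hact (heisGam beta xi) s.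

Lemma gscaleDr S a (s s' : S) : gscale a (s + s') = gscale a s + gscale a s'.
Proof. exact: KGscalerDr. Qed.

Lemma gscaleDl S a b (s : S) : gscale (a + b) s = gscale a s + gscale b s.
Proof. exact: KGscalerDl. Qed.

Lemma gscaler0 S a : gscale a (0 : S) = 0.
Proof. exact: KGscaler0. Qed.

Lemma gscale0r S (s : S) : gscale 0 s = 0.
Proof. exact: KGscale0r. Qed.

Lemma gscaleA S a b (s : S) : gscale a (gscale b s) = gscale (gmul a b) s.
Proof. exact: KGscalerA. Qed.

Lemma gscale1 S (s : S) : gscale (gone K G) s = s.
Proof. exact: KGscale1r. Qed.

Lemma gscaleMl S a (s s' : S) : cmul (gscale a s) s' = gscale a (cmul s s').
Proof. exact: KGcmulZl. Qed.

Lemma gscaleMr S a (s s' : S) : cmul s (gscale a s') = gscale a (cmul s s').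
Proof. by rewrite cmulC gscaleMl cmulC. Qed.

Lemma gscale_gelt S c x (s : S) :
  gscale (gelt c x) s = c *: hact (heisG beta x) s.
Proof. exact: KGscaleU. Qed.

Lemma scale_gscale S c (s : S) : c *: s = gscale (gelt c 0) s.
Proof. by rewrite gscale_gelt hact1. Qed.

(** In the Heisenberg group c (x, xi) = c . (x, 0) . (0, xi), with no pairing factor since <0|.> =
    1. Hence [gscale] and [gam] together recover the whole action. *)
Lemma hact_gscale S h (s : S) :
  hact h s = gscale (gelt (eps (hT h)) (hG h)) (gam (hGam h) s).
Proof.
rewrite gscale_gelt /gam -hact_T -!hactM; congr (hact _ s).
case: h => c x xi /=.
rewrite -[RHS]/(heis_mul (heis_mul _ _) _) /heis_mul /=.
by rewrite !addr0 !add0r !pairing0l !mulg1.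
Qed.

Lemma gamD S xi (s s' : S) : gam xi (s + s') = gam xi s + gam xi s'.
Proof. exact: hactD. Qed.

Lemma gam0 S xi : gam xi (0 : S) = 0.
Proof. exact: hact0. Qed.

(** In H(beta), xi and x commute only up to <xi|x>, so [gam xi] is semilinear over KG: it twists the
    scalars. *)
Lemma gam_gelt S xi c x (s : S) :
  gam xi (gscale (gelt c x) s) =
  gscale (gelt (c * eps (beta xi x)) x) (gam xi s).
Proof. exact: (@hact_gelt _ _ _ _ _ _ S). Qed.

Lemma cmul0l S (s : S) : cmul 0 s = 0.
Proof. by apply: (addIr (cmul 0 s)); rewrite -cmulDl !add0r. Qed.

Lemma cmul0r S (s : S) : cmul s 0 = 0.
Proof. by rewrite cmulC cmul0l. Qed.

(** * Morphisms as KG-linear, multiplicative and Gam-equivariant maps *)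

Section BuildHom.
Variables (S S' : HA) (f : S -> S').
Hypothesis fD : forall s s', f (s + s') = f s + f s'.
Hypothesis fZ : forall a s, f (gscale a s) = gscale a (f s).
Hypothesis fM : forall s s', f (cmul s s') = cmul (f s) (f s').
Hypothesis fG : forall xi s, f (gam xi s) = gam xi (f s).

(** A scalar c of K acts as [gelt c 0], so KG-linearity contains K-linearity. *)
Fact build_linear : linear f.
Proof. by move=> c s s'; rewrite fD !scale_gscale fZ. Qed.

Fact build_act h s : f (hact h s) = hact h (f s).
Proof. by rewrite !hact_gscale fZ fG. Qed.

Definition build_hom : heis_hom S S' := HeisHom build_linear fM build_act.
End BuildHom.

Lemma heis_compE S S' S'' (g : heis_hom S' S'') (f : heis_hom S S') s :
  heis_comp g f s = g (f s).
Proof. by []. Qed.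

Section HomTheory.
Variables (S S' : HA) (f : heis_hom S S').

Lemma hfunD s s' : f (s + s') = f s + f s'.
Proof. by rewrite -[s]scale1r hfun_linear !scale1r. Qed.

Lemma hfun0 : f 0 = 0.
Proof. by apply: (addIr (f 0)); rewrite -hfunD !add0r. Qed.

Lemma hfun_gscale a s : f (gscale a s) = gscale a (f s).
Proof.
elim/galg_ind: a => [|c x|a a' IH IH']; first by rewrite !gscale0r hfun0.
  (* Adding 0 brings the scalar multiple into the shape required by [hfun_linear]. *)
  rewrite !gscale_gelt -hfun_act -[_ *: _ in LHS]addr0 hfun_linear hfun0.
  by rewrite addr0.
by rewrite !gscaleDl hfunD IH IH'.
Qed.

Lemma hfun_gam xi s : f (gam xi s) = gam xi (f s).
Proof. by rewrite /gam hfun_act. Qed.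

End HomTheory.

(** * Pure tensors in the language of [gscale] and [gam] *)

Section Tensor.
Variables A B : HA.
Implicit Types (u v : A) (w : B) (t : A ** B).

Lemma hpureDl u v w : hpure (u + v) w = hpure u w + hpure v w.
Proof. exact: (@pureDl KG (KGalg A) (KGalg B)). Qed.

Lemma hpureDr u w w' : hpure u (w + w') = hpure u w + hpure u w'.
Proof. exact: (@pureDr KG (KGalg A) (KGalg B)). Qed.

Lemma hpure0l w : hpure (0 : A) w = 0.
Proof. exact: (@pure0l KG (KGalg A) (KGalg B)). Qed.

Lemma hpure0r u : hpure u (0 : B) = 0.
Proof. exact: (@pure0r KG (KGalg A) (KGalg B)). Qed.

Lemma hpure_gscale a u w : hpure (gscale a u) w = hpure u (gscale a w).
Proof. exact: (@pureZ KG (KGalg A) (KGalg B)). Qed.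

(** KG acts on a tensor product in two ways: through the Heisenberg action, as on every object, and
    through the tensor product of KG-modules. Their agreement makes the facts about modules over KG
    available for [gscale]. *)
Lemma htens_gscale a t : gscale a t = a *: (t : tensor (KGalg A) (KGalg B)).
Proof.
elim/galg_ind: a => [|c x|a a' IH IH']; first by rewrite gscale0r scale0r.
  rewrite gscale_gelt -[LHS]/(gelt c 0 *: (gelt _ x *: tgam 0 t)).
  by rewrite tgam_0 scale_gelt add0r uchar1 mulr1.
by rewrite gscaleDl IH IH' scalerDl.
Qed.

Lemma gscale_hpure a u w : gscale a (hpure u w) = hpure (gscale a u) w.
Proof.
by rewrite htens_gscale; apply: (@scale_pure KG (KGalg A) (KGalg B)).
Qed.

Lemma htens_gam xi t : gam xi t = tgam xi t.
Proof.
by rewrite -[LHS]/(gelt (eps 1%g) 0 *: tgam xi t) uchar1; apply: scale1r.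
Qed.

Lemma gam_hpure xi u w : gam xi (hpure u w) = hpure (gam xi u) (gam xi w).
Proof. by rewrite htens_gam; apply: (tgamE (S := A) (S' := B)). Qed.

Lemma cmul_hpure u v w w' :
  cmul (hpure u w) (hpure v w') = hpure (cmul u v) (cmul w w').
Proof. exact: (@tmul_pure KG (KGalg A) (KGalg B)). Qed.

Lemma htens_ind (P : A ** B -> Prop) :
  P 0 -> (forall u w, P (hpure u w)) ->
  (forall t t', P t -> P t' -> P (t + t')) ->
  forall t, P t.
Proof. exact: (@tensor_ind KG (KGalg A) (KGalg B)). Qed.

(** * The universal property of the tensor product *)

Definition gbalanced (V : zmodType) (f : A -> B -> V) := [/\
  forall u v w, f (u + v) w = f u w + f v w,
  forall u w w', f u (w + w') = f u w + f u w' &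
  forall a u w, f (gscale a u) w = f u (gscale a w)].

Section Lift.
Variables (V : zmodType) (f : A -> B -> V).
Hypothesis fbal : gbalanced f.

Definition glift t : V :=
  @tlift KG (KGalg A) (KGalg B) V f t.

Lemma gliftE u w : glift (hpure u w) = f u w.
Proof. exact: (@tliftE KG (KGalg A) (KGalg B) V f fbal). Qed.

Lemma gliftD t t' : glift (t + t') = glift t + glift t'.
Proof. exact: (@tliftD KG (KGalg A) (KGalg B) V f fbal). Qed.

Lemma glift0 : glift 0 = 0.
Proof. exact: (@tlift0 KG (KGalg A) (KGalg B) V f fbal). Qed.
End Lift.

Section LiftHom.
Variables (S : HA) (f : A -> B -> S).
Hypothesis fDl : forall u v w, f (u + v) w = f u w + f v w.
Hypothesis fDr : forall u w w', f u (w + w') = f u w + f u w'.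
Hypothesis fZl : forall a u w, f (gscale a u) w = gscale a (f u w).
Hypothesis fZr : forall a u w, f u (gscale a w) = gscale a (f u w).
Hypothesis fM : forall u v w w',
  f (cmul u v) (cmul w w') = cmul (f u w) (f v w').
Hypothesis fG : forall xi u w, f (gam xi u) (gam xi w) = gam xi (f u w).

Let fbal : gbalanced f.
Proof. by split=> // a u w; rewrite fZl fZr. Qed.

(** This condition and the next two are additive in each tensor involved, so the hypotheses on [f],
    which concern pure tensors, suffice. *)
Fact lift_gscale a t : glift f (gscale a t) = gscale a (glift f t).
Proof.
elim/htens_ind: t => [|u w|t t' IH IH'].
- by rewrite !(gscaler0, glift0 fbal).
- by rewrite gscale_hpure !(gliftE fbal).
- by rewrite !(gscaleDr, gliftD fbal) IH IH'.
Qed.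

Fact lift_cmul t t' : glift f (cmul t t') = cmul (glift f t) (glift f t').
Proof.
elim/htens_ind: t => [|u w|t1 t2 IH1 IH2].
- by rewrite (glift0 fbal) !cmul0l (glift0 fbal).
- elim/htens_ind: t' => [|v w'|t1 t2 IH1 IH2].
  + by rewrite (glift0 fbal) !cmul0r (glift0 fbal).
  + by rewrite cmul_hpure !(gliftE fbal).
  + by rewrite !(cmulDr, gliftD fbal) IH1 IH2.
- by rewrite !(cmulDl, gliftD fbal) IH1 IH2.
Qed.

Fact lift_gam xi t : glift f (gam xi t) = gam xi (glift f t).
Proof.
elim/htens_ind: t => [|u w|t t' IH IH'].
- by rewrite !(gam0, glift0 fbal).
- by rewrite gam_hpure !(gliftE fbal).
- by rewrite !(gamD, gliftD fbal) IH IH'.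
Qed.

Definition hlift : heis_hom (A ** B) S :=
  build_hom (gliftD fbal) lift_gscale lift_cmul lift_gam.

Lemma hliftE u w : hlift (hpure u w) = f u w.
Proof. exact: gliftE. Qed.
End LiftHom.

(** Pure tensors generate additively, and morphisms are determined by their underlying functions.
    This turns each coherence law into a computation. *)
Lemma htens_hom_ext S (f g : heis_hom (A ** B) S) :
  (forall u w, f (hpure u w) = g (hpure u w)) -> f = g.
Proof.
move=> fg; apply/heis_homP/funext; elim/htens_ind => [|//|t t' IH IH'].
  by rewrite !hfun0.
by rewrite !hfunD IH IH'.
Qed.

End Tensor.

(** Brackets are opened one at a time: with the outer entries fixed, both sides are additive in the
    inner tensor. *)
Lemma htens3_hom_ext A B D S (f g : heis_hom (A ** B ** D) S) :
  (forall u v w, f (hpure (hpure u v) w) = g (hpure (hpure u v) w)) -> f = g.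
Proof.
move=> fg; apply: htens_hom_ext => t w.
elim/htens_ind: t => [|//|t t' IH IH']; first by rewrite hpure0l !hfun0.
by rewrite hpureDl !hfunD IH IH'.
Qed.

Lemma htens4_hom_ext A B D E S (f g : heis_hom (A ** B ** D ** E) S) :
  (forall u v w z, f (hpure (hpure (hpure u v) w) z) =
                   g (hpure (hpure (hpure u v) w) z)) -> f = g.
Proof.
move=> fg; apply: htens3_hom_ext => t w z.
elim/htens_ind: t => [|//|t t' IH IH']; first by rewrite !hpure0l !hfun0.
by rewrite !hpureDl !hfunD IH IH'.
Qed.

Lemma htens3r_hom_ext A B D S (f g : heis_hom (A ** (B ** D)) S) :
  (forall u v w, f (hpure u (hpure v w)) = g (hpure u (hpure v w))) -> f = g.
Proof.
move=> fg; apply: htens_hom_ext => u t.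
elim/htens_ind: t => [|//|t t' IH IH']; first by rewrite hpure0r !hfun0.
by rewrite hpureDr !hfunD IH IH'.
Qed.

(** * The tensor product of morphisms and the braiding *)

Section TensorMap.
Variables (A A' B B' : HA) (f : heis_hom A A') (g : heis_hom B B').

(** Kept transparent by [Defined], so that [hmapE] can read the value on pure tensors off
    [hliftE]. *)
Definition hmap : heis_hom (A ** B) (A' ** B').
Proof.
apply: (@hlift _ _ _ (fun u w => hpure (f u) (g w))).
- by move=> u v w; rewrite hfunD hpureDl.
- by move=> u w w'; rewrite hfunD hpureDr.
- by move=> a u w; rewrite gscale_hpure hfun_gscale.
- by move=> a u w; rewrite gscale_hpure hpure_gscale hfun_gscale.
- by move=> u v w w'; rewrite cmul_hpure !hfunM.
- by move=> xi u w; rewrite gam_hpure !hfun_gam.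
Defined.

Lemma hmapE u w : hmap (hpure u w) = hpure (f u) (g w).
Proof. exact: hliftE. Qed.
End TensorMap.

Section Braiding.
Variables A B : HA.

Definition hbraid : heis_hom (A ** B) (B ** A).
Proof.
apply: (@hlift _ _ _ (fun u w => hpure w u)).
- by move=> u v w; rewrite hpureDr.
- by move=> u w w'; rewrite hpureDl.
- by move=> a u w; rewrite gscale_hpure hpure_gscale.
- by move=> a u w; rewrite gscale_hpure.
- by move=> u v w w'; rewrite cmul_hpure.
- by move=> xi u w; rewrite gam_hpure.
Defined.

Lemma hbraidE u w : hbraid (hpure u w) = hpure w u.
Proof. exact: hliftE. Qed.
End Braiding.

(** * The associator *)

Section Associator.
Variables A B D : HA.

(** The associator arises from two nested lifts. For fixed [d] the inner map is in general neither
    multiplicative nor Gam-equivariant, so the inner lift is the additive [glift]; only the outer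
    one is an [hlift]. *)
Definition assoc2 (t : A ** B) (d : D) : A ** (B ** D) :=
  glift (fun u v => hpure u (hpure v d)) t.

Let bal (d : D) : gbalanced (fun (u : A) (v : B) => hpure u (hpure v d)).
Proof.
split=> [u u' v|u v v'|a u v]; first by rewrite hpureDl.
  by rewrite hpureDl hpureDr.
by rewrite hpure_gscale gscale_hpure.
Qed.

Fact assoc2E u v d : assoc2 (hpure u v) d = hpure u (hpure v d).
Proof. exact: gliftE (bal d) u v. Qed.

Fact assoc2Dl t t' d : assoc2 (t + t') d = assoc2 t d + assoc2 t' d.
Proof. exact: gliftD (bal d) t t'. Qed.

Fact assoc20 d : assoc2 0 d = 0.
Proof. exact: glift0 (bal d). Qed.

Definition hassoc : heis_hom (A ** B ** D) (A ** (B ** D)).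
Proof.
apply: (@hlift _ _ _ assoc2); first exact: assoc2Dl.
- move=> t d d'; elim/htens_ind: t => [|u v|t t' IH IH'].
  + by rewrite !assoc20 addr0.
  + by rewrite !assoc2E !hpureDr.
  + by rewrite !assoc2Dl IH IH' addrACA.
- move=> a t d; elim/htens_ind: t => [|u v|t t' IH IH'].
  + by rewrite gscaler0 assoc20 gscaler0.
  + by rewrite gscale_hpure !assoc2E gscale_hpure.
  + by rewrite gscaleDr !assoc2Dl gscaleDr IH IH'.
- move=> a t d; elim/htens_ind: t => [|u v|t t' IH IH'].
  + by rewrite !assoc20 gscaler0.
  (* The scalar is carried from the first factor to the third, across both tensor signs. *)
  + by rewrite !assoc2E gscale_hpure hpure_gscale gscale_hpure hpure_gscale.
  + by rewrite !assoc2Dl gscaleDr IH IH'.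
- move=> t t' d d'; elim/htens_ind: t => [|u v|t1 t2 IH1 IH2].
  + by rewrite assoc20 !cmul0l assoc20.
  + elim/htens_ind: t' => [|u' v'|t1 t2 IH1 IH2].
    * by rewrite assoc20 !cmul0r assoc20.
    * by rewrite cmul_hpure !assoc2E !cmul_hpure.
    * by rewrite cmulDr !assoc2Dl cmulDr IH1 IH2.
  + by rewrite cmulDl !assoc2Dl cmulDl IH1 IH2.
- move=> xi t d; elim/htens_ind: t => [|u v|t t' IH IH'].
  + by rewrite gam0 !assoc20 gam0.
  + by rewrite gam_hpure !assoc2E !gam_hpure.
  + by rewrite gamD !assoc2Dl gamD IH IH'.
Defined.

Lemma hassocE u v w : hassoc (hpure (hpure u v) w) = hpure u (hpure v w).
Proof. by rewrite /hassoc hliftE assoc2E. Qed.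
End Associator.

(** * The unit object KG *)

Section Unit.

Definition regular_alg : calg KG :=
  @CAlg KG (KG^o) (@gmul K G) (@gmulA K G) (@gmulC K G) (@gmulDl K G)
    (fun a s s' => esym (gmulA a s s')).

(** The formula is forced once xi fixes the neutral element 1 of KG: xi.x = xi.(x.1) = <xi|x>
    x.(xi.1). *)
Definition ugam xi (a : KG) : KG :=
  malg_lift (fun x c => gelt (c * eps (beta xi x)) x) a.

Let ufam xi : additive_family
  (fun x c => gelt (c * eps (beta xi x)) x : {malg K[G]}).
Proof. by move=> x c d; rewrite mulrDl geltD. Qed.

Lemma ugamE xi c x : ugam xi (gelt c x) = gelt (c * eps (beta xi x)) x.
Proof. exact: (malg_liftU _ _ (ufam xi)). Qed.

Lemma ugamD xi a b : ugam xi (a + b) = ugam xi a + ugam xi b.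
Proof. exact: (malg_liftD (ufam xi)). Qed.

Lemma ugam0 xi : ugam xi 0 = 0.
Proof. by apply: (addIr (ugam xi 0)); rewrite -ugamD !add0r. Qed.

(** Each xi gives a character <xi|.> of G, and twisting coefficients by a character respects the
    product of the group algebra. *)
Lemma ugamM xi a b : ugam xi (gmul a b) = gmul (ugam xi a) (ugam xi b).
Proof.
elim/galg_ind: a => [|c x|a a' IH IH']; first by rewrite !(g0mul, ugam0).
  elim/galg_ind: b => [|d y|b b' IH IH']; first by rewrite !(gmul0, ugam0).
    by rewrite gmulUU !ugamE gmulUU pairingDr ucharM mulrACA.
  by rewrite !(gmulDr, ugamD) IH IH'.
by rewrite !(gmulDl, ugamD) IH IH'.
Qed.

Lemma ugam_0 a : ugam 0 a = a.
Proof.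
elim/galg_ind: a => [|c x|a a' IH IH']; first by rewrite ugam0.
  by rewrite ugamE pairing0l uchar1 mulr1.
by rewrite ugamD IH IH'.
Qed.

Lemma ugam_add xi eta a : ugam (xi + eta) a = ugam xi (ugam eta a).
Proof.
elim/galg_ind: a => [|c x|a a' IH IH']; first by rewrite !ugam0.
  by rewrite !ugamE pairingDl ucharM -mulrA (mulrC (eps (beta eta x))).
by rewrite !ugamD IH IH'.
Qed.

Definition uact (h : heis beta) (a : Kalg regular_alg) : Kalg regular_alg :=
  gmul (gelt (eps (hT h)) (hG h)) (ugam (hGam h) a).

Fact uact1 (a : Kalg regular_alg) : uact 1%g a = a.
Proof. by rewrite /uact /= uchar1 ugam_0; apply: gmul1. Qed.

Fact uactM h k (a : Kalg regular_alg) : uact (h * k)%g a = uact h (uact k a).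
Proof.
(* Moving the Gam-part of [h] past the G-part of [k] produces exactly the pairing factor in
   [heis_mul]. *)
rewrite /uact /= ugamM ugamE gmulA gmulUU ugam_add !ucharM -!mulrA.
by rewrite (mulrC (eps (hT k))).
Qed.

Fact uact_linear h : linear (uact h).
Proof.
move=> c a b; rewrite /uact ugamD gmulDr; congr (_ + _).
rewrite -[c *: a]/(gmul (gelt c 0) a) -[RHS]/(gmul (gelt c 0) _).
(* The scalar [gelt c 0] is fixed by [ugam] because <xi|0> = 1. *)
rewrite ugamM ugamE pairing0r uchar1 mulr1 !gmulA.
by rewrite (gmulC (gelt c 0)).
Qed.

Fact uact_T c (a : Kalg regular_alg) : uact (heisT beta c) a = eps c *: a.
Proof. by rewrite /uact /= ugam_0. Qed.

Fact uact_G x (a b : Kalg regular_alg) :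
  uact (heisG beta x) (cmul a b) = cmul (uact (heisG beta x) a) b.
Proof. by rewrite /uact /= !ugam_0; apply: gmulA. Qed.

Fact uact_Gam xi (a b : Kalg regular_alg) : uact (heisGam beta xi) (cmul a b) =
  cmul (uact (heisGam beta xi) a) (uact (heisGam beta xi) b).
Proof. by rewrite /uact /= uchar1 !gmul1; apply: ugamM. Qed.

Definition hunit : HA :=
  HeisAlg uact1 uactM uact_linear uact_T uact_G uact_Gam.

Lemma gam_hunit xi (b : hunit) : gam xi b = ugam xi b.
Proof. by rewrite -[LHS]/(uact _ _) /uact /= uchar1 gmul1. Qed.

(** On the unit, too, the KG-action derived from the Heisenberg action has to be matched with the
    given one, here multiplication. *)
Lemma gscale_hunit a (b : hunit) : gscale a b = gmul a b.
Proof.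
elim/galg_ind: a => [|c x|a a' IH IH']; first by rewrite gscale0r g0mul.
  rewrite gscale_gelt -[LHS]/(gmul (gelt c 0) (uact _ _)) /uact /= ugam_0.
  by rewrite uchar1 gmulA gmulUU mulr1 add0r.
by rewrite gscaleDl IH IH' gmulDl.
Qed.

(** This is the Gam-equivariance of the action map from KG and S to S, which makes the left unitor a
    morphism. *)
Lemma gam_gscale S xi a (s : S) :
  gam xi (gscale a s) = gscale (ugam xi a) (gam xi s).
Proof.
elim/galg_ind: a => [|c x|a a' IH IH'].
- by rewrite ugam0 !gscale0r gam0.
- by rewrite ugamE gam_gelt.
- by rewrite ugamD !gscaleDl gamD IH IH'.
Qed.

(** * The unitors *)

Variable A : HA.

Definition hlunit : heis_hom (hunit ** A) A.
Proof.
apply: (@hlift _ _ _ (fun (a : hunit) s => gscale a s)).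
- by move=> a b s; apply: gscaleDl.
- by move=> a s s'; apply: gscaleDr.
- by move=> a b s; rewrite gscale_hunit gscaleA.
- by move=> a b s; rewrite !gscaleA gmulC.
- by move=> a b s s'; rewrite gscaleMl gscaleMr gscaleA.
- by move=> xi a s; rewrite gam_gscale gam_hunit.
Defined.

Lemma hlunitE (a : hunit) s : hlunit (hpure a s) = gscale a s.
Proof. exact: hliftE. Qed.

(** Although objects need not be unital, KG has the neutral element [gone]. It is idempotent, which
    gives multiplicativity, and fixed by Gam, which gives equivariance. *)
Definition hlunit_inv : heis_hom A (hunit ** A).
Proof.
apply: (@build_hom _ _ (fun s => hpure (gone K G : hunit) s)).
- by move=> s s'; apply: hpureDr.
- by move=> a s; rewrite gscale_hpure hpure_gscale.
- by move=> s s'; rewrite cmul_hpure -[cmul (c := hunit) _ _]/(gmul _ _) gmul1.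
- by move=> xi s; rewrite gam_hpure gam_hunit ugamE pairing0r uchar1 mulr1.
Defined.

Lemma hlunit_invE s : hlunit_inv s = hpure (gone K G : hunit) s.
Proof. by []. Qed.

Definition hrunit : heis_hom (A ** hunit) A :=
  heis_comp hlunit (hbraid A hunit).

Lemma hrunitE s (a : hunit) : hrunit (hpure s a) = gscale a s.
Proof. by rewrite heis_compE hbraidE hlunitE. Qed.

End Unit.

(** * Invertibility of the structure maps *)

Lemma hbraidK A B : heis_comp (hbraid B A) (hbraid A B) = heis_id (A ** B).
Proof. by apply: htens_hom_ext => u w; rewrite heis_compE !hbraidE. Qed.

Lemma hlunit_iso A : @is_iso (AlgH beta eps) (hunit ** A) A (hlunit A).
Proof.
exists (hlunit_inv A); split; last first.
  apply/heis_homP/funext => s.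
  by rewrite heis_compE hlunit_invE hlunitE gscale1.
apply: htens_hom_ext => a s; rewrite heis_compE hlunitE hlunit_invE.
(* Balancing moves [a] across the tensor sign, from [s] to the neutral element of KG. *)
by rewrite -hpure_gscale gscale_hunit gmulC gmul1.
Qed.

Lemma hrunit_iso A : @is_iso (AlgH beta eps) (A ** hunit) A (hrunit A).
Proof.
have [g [gl lg]] := hlunit_iso A.
exists (heis_comp (hbraid hunit A) g); split=> /=.
  rewrite /hrunit heis_compmA -(heis_compmA _ g) [heis_comp g _]gl.
  by rewrite heis_compm1 hbraidK.
rewrite /hrunit heis_compmA -(heis_compmA (hlunit A)) hbraidK heis_compm1.
exact: lg.
Qed.

Lemma hassoc_iso A B D :
  @is_iso (AlgH beta eps) (A ** B ** D) (A ** (B ** D)) (hassoc A B D).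
Proof.
(* The witness rotates the factors: A(BD) -> (BD)A -> B(DA) -> (DA)B -> D(AB) -> (AB)D. *)
exists (heis_comp (hbraid D (A ** B)) (heis_comp (hassoc D A B)
  (heis_comp (hbraid B (D ** A)) (heis_comp (hassoc B D A)
    (hbraid A (B ** D)))))).
split.
  apply: htens3_hom_ext => u v w.
  by rewrite !heis_compE hassocE hbraidE hassocE hbraidE hassocE hbraidE.
apply: htens3r_hom_ext => u v w.
by rewrite !heis_compE hbraidE hassocE hbraidE hassocE hbraidE hassocE.
Qed.

(** * Functoriality, naturality and coherence *)

Lemma hmap1 A B : hmap (heis_id A) (heis_id B) = heis_id (A ** B).
Proof. by apply: htens_hom_ext => u w; rewrite hmapE. Qed.

Lemma hmapM A A' A'' B B' B'' (f : heis_hom A A') (f' : heis_hom A' A'')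
    (g : heis_hom B B') (g' : heis_hom B' B'') :
  hmap (heis_comp f' f) (heis_comp g' g) = heis_comp (hmap f' g') (hmap f g).
Proof. by apply: htens_hom_ext => u w; rewrite heis_compE !hmapE. Qed.

Lemma hassoc_nat A A' B B' D D' (f : heis_hom A A') (g : heis_hom B B')
    (h : heis_hom D D') :
  heis_comp (hassoc A' B' D') (hmap (hmap f g) h) =
  heis_comp (hmap f (hmap g h)) (hassoc A B D).
Proof.
by apply: htens3_hom_ext => u v w; rewrite !(heis_compE, hassocE, hmapE).
Qed.

Lemma hlunit_nat A A' (f : heis_hom A A') :
  heis_comp (hlunit A') (hmap (heis_id hunit) f) = heis_comp f (hlunit A).
Proof.
by apply: htens_hom_ext => a s; rewrite !heis_compE hmapE !hlunitE hfun_gscale.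
Qed.

Lemma hrunit_nat A A' (f : heis_hom A A') :
  heis_comp (hrunit A') (hmap f (heis_id hunit)) = heis_comp f (hrunit A).
Proof.
apply: htens_hom_ext => s a.
(* Restricting [heis_compE] to [f] keeps [hrunit], itself a composite, folded for [hrunitE]. *)
by rewrite !(heis_compE f) heis_compE hmapE !hrunitE hfun_gscale.
Qed.

Lemma hbraid_nat A A' B B' (f : heis_hom A A') (g : heis_hom B B') :
  heis_comp (hbraid A' B') (hmap f g) = heis_comp (hmap g f) (hbraid A B).
Proof.
by apply: htens_hom_ext => u w; rewrite !(heis_compE, hmapE, hbraidE).
Qed.

Lemma hpentagon A B D E :
  heis_comp (hassoc A B (D ** E)) (hassoc (A ** B) D E) =
  heis_comp (heis_comp (hmap (heis_id A) (hassoc B D E)) (hassoc A (B ** D) E))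
    (hmap (hassoc A B D) (heis_id E)).
Proof.
by apply: htens4_hom_ext => u v w z; rewrite !(heis_compE, hassocE, hmapE).
Qed.

(** On pure tensors the two sides put the scalar [a] on [w] and on [u] respectively, so the law is
    the balancing relation over KG. *)
Lemma htriangle A B :
  heis_comp (hmap (heis_id A) (hlunit B)) (hassoc A hunit B) =
  hmap (hrunit A) (heis_id B).
Proof.
apply: htens3_hom_ext => u a w.
by rewrite heis_compE hassocE !hmapE hrunitE hlunitE hpure_gscale.
Qed.

Lemma hhexagon A B D :
  heis_comp (heis_comp (hassoc B D A) (hbraid A (B ** D))) (hassoc A B D) =
  heis_comp (heis_comp (hmap (heis_id B) (hbraid A D)) (hassoc B A D))
    (hmap (hbraid A B) (heis_id D)).
Proof.
apply: htens3_hom_ext => u v w.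
by rewrite !(heis_compE, hassocE, hbraidE, hmapE).
Qed.

Definition heis_sym_monoidal :
    @sym_monoidal (AlgH beta eps) (@htens Gam G T K beta eps) :=
  @SymMonoidal (AlgH beta eps) (@htens Gam G T K beta eps)
    hmap hunit hassoc hlunit hrunit hbraid hmap1 hmapM
    hassoc_iso hlunit_iso hrunit_iso
    hassoc_nat hlunit_nat hrunit_nat hbraid_nat
    hpentagon htriangle hhexagon hbraidK.

End HeisenbergMonoidal.

(** As pure tensors generate additively, the three formulas determine the tensor product of
    morphisms, the associator and the braiding. *)
Theorem theorem18 (Gam G : zmodType) (T : abGroupType) (K : comPzRingType)
    (beta : duality Gam G T) (eps : unit_char T K) :
  exists M : @sym_monoidal (AlgH beta eps) (@htens Gam G T K beta eps),
  [/\ forall (A A' B B' : heis_alg beta eps)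
        (f : heis_hom A A') (g : heis_hom B B') (a : A) (b : B),
        hfun (tens_map M f g) (hpure a b) = hpure (f a) (g b),
      forall (A B C : heis_alg beta eps) (a : A) (b : B) (c : C),
        hfun (massoc M A B C) (hpure (hpure a b) c) = hpure a (hpure b c) &
      forall (A B : heis_alg beta eps) (a : A) (b : B),
        hfun (braid M A B) (hpure a b) = hpure b a].
Proof.
exists (heis_sym_monoidal beta eps); split.
- exact: hmapE.
- exact: hassocE.
- exact: hbraidE.
Qed.
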